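(* Let $Z$ be a smooth $3$-dimensional toric variety whose fan contains two maximal cones $\mathrm{cone}(v_1,v_2,v_+)$ and $\mathrm{cone}(v_1,v_2,v_-)$ with $v_1,v_2,v_\pm$ primitive and $v_++v_-=x_1v_1+x_2v_2$, where $x_1,x_2$ are integers with $x_1\ge x_2\ge 0$. Suppose moreover that $x_1\ge 2$. Then the anticanonical bundle of any toric variety obtained from $Z$ by a sequence of blow-ups along torus-invariant subvarieties is not ample.
   Context: Toric varieties are for a 3-dimensional torus $S$, fans in $\chi_*(S)_{\mathbb{R}}$. A blow-up along a torus-invariant subvariety (orbit closure, corresponding to a cone $\tau$ of dimension $\ge2$) of a smooth toric variety is the toric variety obtained by star subdivision of the fan at the sum of the primitive generators of $\tau$. *)

(* Defs.v *)
From HB Require Import structures.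
From mathcomp Require Import all_boot all_order all_algebra.
From mathcomp Require Import finmap.
Set Implicit Arguments. Unset Strict Implicit. Unset Printing Implicit Defensive.
Import Order.TTheory GRing.Theory Num.Theory.
Local Open Scope ring_scope.
Local Open Scope fset_scope.

Definition vec := 'rV[int]_3.

(** A (simplicial) cone is given by its finite set of generators.
    A fan is given by the finite set of all its cones (faces included). *)
Definition gens := {fset vec}.
Definition fan := {fset gens}.

(** Real (here rational; all cones are rational) points of N_R. *)
Definition vecQ (v : vec) : 'rV[rat]_3 := map_mx (fun z : int => z%:~R) v.

Definition in_cone (S : gens) (x : 'rV[rat]_3) : Prop :=
  exists l : vec -> rat, (forall v, 0 <= l v) /\
    x = \sum_(v <- enum_fset S) l v *: vecQ v.

Definition smooth_cone (S : gens) : Prop :=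
  exists M : 'M[int]_3, (\det M = 1 \/ \det M = -1) /\
    (forall v, v \in S -> exists i, row i M = v).

(** A smooth fan in N_R = R^3: every cone smooth, closed under faces
    (faces of a simplicial cone = subsets of its generators), and any two
    cones intersect in a common face. *)
Definition smooth_fan (F : fan) : Prop :=
  [/\ forall S, S \in F -> smooth_cone S,
      forall S T, S \in F -> T `<=` S -> T \in F &
      forall S T x, S \in F -> T \in F -> in_cone S x -> in_cone T x ->
        in_cone (S `&` T) x].

(** Support |F| of the fan, and its convexity (|F| is a cone, so convexity
    amounts to closure under addition). *)
Definition in_support (F : fan) (x : 'rV[rat]_3) : Prop :=
  exists S, S \in F /\ in_cone S x.

Definition convex_support (F : fan) : Prop :=
  forall x y, in_support F x -> in_support F y -> in_support F (x + y)%R.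

Definition is_ray (F : fan) (v : vec) : Prop := [fset v] \in F.

(** Star subdivision of F at the sum of the generators of tau
    (= toric blow-up along the orbit closure V(tau)), cf. CLS 3.3.13:
    cones not containing tau, together with cone(S, u_tau) for S in F
    not containing tau with S cup tau in F. *)
Definition star_sub (F : fan) (tau : gens) : fan :=
  let u := \sum_(v <- enum_fset tau) v in
  [fset S in F | ~~ (tau `<=` S)] `|`
  [fset (S `|` [fset u]) | S in [fset S in F | ~~ (tau `<=` S) && ((S `|` tau) \in F)]].

Definition blowup_step (F F' : fan) : Prop :=
  exists tau, [/\ tau \in F, (2 <= #|` tau|)%N & F' = star_sub F tau].

Inductive blowups : fan -> fan -> Prop :=
| blowups_refl F : blowups F F
| blowups_step F G H : blowup_step F G -> blowups G H -> blowups F H.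

Definition dotQ (m : 'rV[rat]_3) (v : vec) : rat :=
  \sum_(i < 3) m 0 i * (v 0 i)%:~R.

(** Ampleness of the anticanonical divisor -K = sum_rho D_rho (all a_rho = 1)
    of a toric variety whose fan has full-dimensional convex support,
    via the support-function criterion of Cox-Little-Schenck Thm 6.1.14/
    Lemma 6.1.13: for every maximal (3-dimensional) cone sigma, the m_sigma
    with <m_sigma, u_rho> = -1 for rho in sigma(1) satisfies
    <m_sigma, u_rho> > -1 for every ray rho not in sigma. *)
Definition anticanonical_ample (F : fan) : Prop :=
  forall sigma, sigma \in F -> #|` sigma| = 3%N ->
  forall m : 'rV[rat]_3, (forall v, v \in sigma -> dotQ m v = -1) ->
  forall w, is_ray F w -> w \notin sigma -> -1 < dotQ m w.

(* Main.v *)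
Require Import Defs.
From HB Require Import structures.
From mathcomp Require Import all_boot all_order all_algebra.
From mathcomp Require Import finmap zify ring lra.
Import Order.TTheory GRing.Theory Num.Theory.
Set Implicit Arguments. Unset Strict Implicit.
Local Open Scope fset_scope.
Local Open Scope ring_scope.

(* If sigma = cone(a, b, p) is a smooth maximal cone and the maximal cone across its
   facet cone(a, b) is cone(a, b, q) with p + q = y1 a + y2 b, the form m_sigma equal to
   -1 on a, b, p takes the value 1 - y1 - y2 on q, so -K is not ample once y1 + y2 >= 2.
   Call the wall cone(a, b) steep if y1, y2 >= 0 and max(y1, y2) >= 2, as cone(v1, v2) is.
   A star subdivision at tau keeps both cones unless tau is a face of one of them; if tau
   contains the apex p, it replaces p by the sum of tau and so only raises y1 and y2; if
   tau is the wall itself, cone(a, a + b) is a wall with coefficients (y1 - y2, y2) when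
   y1 >= y2, steep again unless (y1, y2) = (2, 1).  In that case the new wall has
   coefficients (1, 1) and its neighbour cone(a + b, p) has coefficients (1, 0); such a
   balanced pair of walls survives every star subdivision too, as a balanced pair or as a
   steep wall.  Hence every iterated blow-up has a wall with y1 + y2 >= 2. *)

(* The three indices of 'I_3, written so that [val] and [mxE] compute on them. *)
Notation i0 := (@ord0 2).
Notation i1 := (@lift 3 ord0 (@ord0 1)).
Notation i2 := (@lift 3 ord0 (@lift 2 ord0 (@ord0 0))).

Ltac vec_ring := apply/rowP => ?; rewrite !mxE; ring.
Ltac fset_cases x := repeat match goal with |- context [x == ?v] => case: (x == v) end.
Ltac fset_eq := let x := fresh "x" in apply/fsetP => x; rewrite !inE; fset_cases x; done.
Ltac fset_sub := let x := fresh "x" in apply/fsubsetP => x; rewrite !inE; fset_cases x; done.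

Definition det3 (a b c : vec) : int :=
  a 0 i0 * (b 0 i1 * c 0 i2 - b 0 i2 * c 0 i1)
  - a 0 i1 * (b 0 i0 * c 0 i2 - b 0 i2 * c 0 i0)
  + a 0 i2 * (b 0 i0 * c 0 i1 - b 0 i1 * c 0 i0).

Lemma det_mx3 (M : 'M[int]_3) : \det M = det3 (row i0 M) (row i1 M) (row i2 M).
Proof.
pose N (n m : nat) := M (inord n) (inord m).
have E x y : M x y = N x y by rewrite /N !inord_val.
rewrite (expand_det_row M ord0) !big_ord_recl big_ord0 /cofactor.
rewrite !(expand_det_row _ ord0) !big_ord_recl !big_ord0 /cofactor !det_mx11.
rewrite /det3 !mxE !E /=; ring.
Qed.

Lemma ord3P (i : 'I_3) : [\/ i = i0, i = i1 | i = i2].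
Proof.
by case: i => [[|[|[|?]]] lti] //; [constructor 1 | constructor 2 | constructor 3];
  apply: val_inj.
Qed.

Lemma det3_row_perm (M : 'M[int]_3) i j k : i != j -> i != k -> j != k ->
  det3 (row i M) (row j M) (row k M) = \det M \/
  det3 (row i M) (row j M) (row k M) = - \det M.
Proof.
rewrite det_mx3.
by case: (ord3P i) => ->; case: (ord3P j) => ->; case: (ord3P k) => -> //= _ _ _;
  [left|right|right|left|left|right]; rewrite /det3 !mxE; ring.
Qed.

Lemma det3_rot a b p : det3 b p a = det3 a b p.
Proof. rewrite /det3; ring. Qed.

Lemma det3_swap a b p : det3 b a p = - det3 a b p.
Proof. rewrite /det3; ring. Qed.

Lemma det3_lincomb a b p (y1 y2 s : int) :
  det3 a b (y1 *: a + y2 *: b + s *: p) = s * det3 a b p.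
Proof. rewrite /det3 !mxE; ring. Qed.

Lemma det3_addr a b p : det3 a (a + b) p = det3 a b p.
Proof. rewrite /det3 !mxE; ring. Qed.

Lemma det3_neq a b c : det3 a b c != 0 -> [/\ a != b, a != c & b != c].
Proof. by move=> D; split; apply: contraNneq D => ->; rewrite /det3; apply/eqP; ring. Qed.

Definition cross (u v : vec) : vec := \row_j
  match val j with
  | 0 => u 0 i1 * v 0 i2 - u 0 i2 * v 0 i1
  | 1 => u 0 i2 * v 0 i0 - u 0 i0 * v 0 i2
  | _ => u 0 i0 * v 0 i1 - u 0 i1 * v 0 i0
  end.

Definition idot (c v : vec) : int := \sum_(i < 3) c 0 i * v 0 i.

Lemma idotE c v : idot c v = c 0 i0 * v 0 i0 + c 0 i1 * v 0 i1 + c 0 i2 * v 0 i2.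
Proof. by rewrite /idot !big_ord_recl big_ord0 addr0 addrA. Qed.

Definition det3_dual (a b p : vec) : vec := cross b p + cross p a + cross a b.

Lemma idot_det3_dual a b p v : v \in [fset a; b; p] -> idot (det3_dual a b p) v = det3 a b p.
Proof.
by rewrite !inE => /orP [/orP [] |] /eqP ->; rewrite idotE /det3_dual /det3 !mxE /=; ring.
Qed.

Lemma dotQ_idot (r : rat) c v : dotQ (r *: vecQ c) v = r * (idot c v)%:~R.
Proof.
rewrite /dotQ /idot rmorph_sum mulr_sumr; apply: eq_bigr => i _.
by rewrite !mxE rmorphM mulrA.
Qed.

Lemma cone_dual_form a b p : det3 a b p != 0 ->
  exists mu : 'rV[rat]_3, (forall v, v \in [fset a; b; p] -> dotQ mu v = -1) /\
    forall y1 y2 : int, dotQ mu (y1 *: a + y2 *: b - p) = 1 - (y1 + y2)%:~R.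
Proof.
move=> D; have Dq : (det3 a b p)%:~R != 0 :> rat by rewrite intr_eq0.
exists (- ((det3 a b p)%:~R)^-1 *: vecQ (det3_dual a b p)); split.
  by move=> v vS; rewrite dotQ_idot idot_det3_dual // mulNr mulVf.
move=> y1 y2; rewrite dotQ_idot.
have -> : idot (det3_dual a b p) (y1 *: a + y2 *: b - p) = (y1 + y2 - 1) * det3 a b p.
  have lin c : idot c (y1 *: a + y2 *: b - p) = y1 * idot c a + y2 * idot c b - idot c p.
    by rewrite !idotE !mxE; ring.
  by rewrite lin !idot_det3_dual ?inE ?eqxx ?orbT //; ring.
rewrite intrM mulrCA mulNr mulVf // mulrN1 intrB intrD; ring.
Qed.

Lemma cardfs3 (a b c : vec) : a != b -> a != c -> b != c -> #|` [fset a; b; c]| = 3%N.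
Proof.
move=> ab ac bc; rewrite -fsetUA !cardfsU1 cardfs1 !inE.
by rewrite negb_or ab ac bc.
Qed.

Lemma cardfs3_neq (a b c : vec) : #|` [fset a; b; c]| = 3%N -> [/\ a != b, a != c & b != c].
Proof.
rewrite -fsetUA !cardfsU1 cardfs1 !inE negb_or.
by case: (a != b); case: (a != c); case: (b != c).
Qed.

Lemma smooth_cone_det3 a b c : smooth_cone [fset a; b; c] -> #|` [fset a; b; c]| = 3%N ->
  det3 a b c != 0.
Proof.
move=> [M [dM rowM]] /cardfs3_neq [ab ac bc].
have [i Ri] := rowM a ltac:(by rewrite !inE eqxx).
have [j Rj] := rowM b ltac:(by rewrite !inE eqxx !orbT).
have [k Rk] := rowM c ltac:(by rewrite !inE eqxx !orbT).
have ij : i != j by apply: contraNneq ab => ij; rewrite -Ri -Rj ij.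
have ik : i != k by apply: contraNneq ac => ik; rewrite -Ri -Rk ik.
have jk : j != k by apply: contraNneq bc => jk; rewrite -Rj -Rk jk.
rewrite -Ri -Rj -Rk.
by case: (det3_row_perm M ij ik jk) => ->; case: dM => ->.
Qed.

Definition face_closed (F : fan) := forall S T, S \in F -> T `<=` S -> T \in F.

Definition gens_sum (tau : gens) : vec := \sum_(v <- enum_fset tau) v.

Lemma gens_sum2 (a b : vec) : a != b -> gens_sum [fset a; b] = a + b.
Proof. by move=> ab; rewrite /gens_sum big_fsetU1 ?inE // big_seq_fset1. Qed.

Lemma gens_sum_sub3 tau (a b c : vec) : a != b -> a != c -> b != c ->
  tau `<=` [fset a; b; c] ->
  gens_sum tau = (a \in tau)%:R *: a + (b \in tau)%:R *: b + (c \in tau)%:R *: c.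
Proof.
move=> ab ac bc sub; rewrite /gens_sum.
rewrite (eq_big_seq (fun v => (v \in tau)%:R *: v)); last by move=> v /= ->; rewrite scale1r.
rewrite (big_fset_incl _ sub); last by move=> v _ /negbTE ->; rewrite scale0r.
rewrite -fsetUA !big_fsetU1 ?big_seq_fset1 ?inE ?negb_or ?ab ?ac ?bc //.
exact: addrA.
Qed.

Lemma fsubset3_notin (tau : gens) a b c : tau `<=` [fset a; b; c] -> (2 <= #|` tau|)%N ->
  c \notin tau -> tau = [fset a; b].
Proof.
move=> /fsubsetP sub ct cnt; apply/eqP; rewrite eqEfcard; apply/andP; split.
  apply/fsubsetP => x xt; have := sub x xt; rewrite !inE -orbA.
  case/or3P => [-> // | -> | /eqP xc]; first by rewrite orbT.
  by move: cnt; rewrite -xc xt.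
by rewrite cardfs2 (leq_trans _ ct) //; case: (_ != _).
Qed.

Lemma fsubset3_mem (tau : gens) a b c : tau `<=` [fset a; b; c] -> (2 <= #|` tau|)%N ->
  (a \in tau) || (b \in tau).
Proof.
move=> /fsubsetP sub ct; apply: contraT; rewrite negb_or => /andP [ant bnt].
have : tau `<=` [fset c].
  apply/fsubsetP => x xt; have := sub x xt; rewrite !inE -orbA => /or3P [] // /eqP xE.
  - by move: ant; rewrite -xE xt.
  - by move: bnt; rewrite -xE xt.
by move/fsubset_leq_card; rewrite cardfs1; case: #|` tau| ct => [|[|]].
Qed.

Lemma star_sub_keep F tau S : S \in F -> ~~ (tau `<=` S) -> S \in star_sub F tau.
Proof. by move=> SF nt; rewrite /star_sub in_fsetU !inE SF nt. Qed.

Lemma star_sub_join F tau S : S \in F -> ~~ (tau `<=` S) -> S `|` tau \in F ->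
  S `|` [fset gens_sum tau] \in star_sub F tau.
Proof.
move=> SF nt St; rewrite /star_sub in_fsetU; apply/orP; right.
by apply: in_imfset; rewrite /= !inE SF nt St.
Qed.

Lemma face_closed_star_sub F tau : face_closed F -> face_closed (star_sub F tau).
Proof.
move=> fc S' T /fsetUP [S'F | /imfsetP [S /= SF' ->]] TS.
  rewrite !inE in S'F; case/andP: S'F => SF nt.
  apply: star_sub_keep; first exact: fc SF TS.
  by apply: contra nt => tT; apply: fsubset_trans tT TS.
set u := \sum_(v <- enum_fset tau) v.
rewrite !inE in SF'; case/andP: SF' => SF /andP [nt St].
have TdS : T `\ u `<=` S.
  apply/fsubsetP => x; rewrite in_fsetD1 => /andP [xu xT].
  by have := fsubsetP TS x xT; rewrite !inE (negbTE xu) orbF.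
have ntT : ~~ (tau `<=` T `\ u) by apply: contra nt => tT; apply: fsubset_trans tT TdS.
have [uT|unT] := boolP (u \in T).
  rewrite -(fsetD1K uT) fsetUC; apply: star_sub_join => //; first exact: fc SF TdS.
  by apply: fc St _; apply: fsetSU.
have TT : T `<=` T `\ u.
  by apply/fsubsetP => x xT; rewrite in_fsetD1 xT andbT; apply: contraNneq unT => <-.
apply: star_sub_keep; first by apply: fc SF _; apply: fsubset_trans TT TdS.
by apply: contra ntT => tT; apply: fsubset_trans tT TT.
Qed.

(* The wall cone(a, b) between the maximal cones cone(a, b, p) and cone(a, b, q),
   where p + q = y1 a + y2 b as for v_+ and v_- in the statement. *)
Definition wall (F : fan) (a b p : vec) (y1 y2 : int) : Prop :=
  [/\ det3 a b p != 0, [fset a; b; p] \in F & [fset a; b; y1 *: a + y2 *: b - p] \in F].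

Lemma det3_apex_notin a b p (y1 y2 : int) : det3 a b p != 0 ->
  p \notin [fset a; b; y1 *: a + y2 *: b - p].
Proof.
move=> D; have [ab ap bp] := det3_neq D.
rewrite !inE !negb_or eq_sym ap eq_sym bp /=; apply: contraNneq D => pE.
have := det3_lincomb a b p y1 y2 (-1); rewrite scaleN1r -pE mulN1r => E.
by apply/eqP; lia.
Qed.

Lemma wall_sym F a b p y1 y2 : wall F a b p y1 y2 -> wall F a b (y1 *: a + y2 *: b - p) y1 y2.
Proof.
move=> [D Sp Sm]; split => //.
  by rewrite -scaleN1r det3_lincomb mulN1r oppr_eq0.
by rewrite subKr.
Qed.

Lemma wall_swap F a b p y1 y2 : wall F a b p y1 y2 -> wall F b a p y2 y1.
Proof.
move=> [D Sp Sm]; split; first by rewrite det3_swap oppr_eq0.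
  by rewrite (_ : [fset b; a; p] = [fset a; b; p]) //; fset_eq.
rewrite (_ : [fset b; a; y2 *: b + y1 *: a - p] = [fset a; b; y1 *: a + y2 *: b - p]) //.
by rewrite (addrC (y2 *: b)); fset_eq.
Qed.

Lemma wall_not_anticanonical_ample F a b p y1 y2 : face_closed F -> wall F a b p y1 y2 ->
  2 <= y1 + y2 -> ~ anticanonical_ample F.
Proof.
move=> fc W hy amp; have [D Sp Sm] := W.
have [ab ap bp] := det3_neq D.
have [mu [mu_cone mu_m]] := cone_dual_form D.
have m_ray : is_ray F (y1 *: a + y2 *: b - p).
  by apply: fc Sm _; rewrite fsub1set !inE eqxx orbT.
have m_notin : y1 *: a + y2 *: b - p \notin [fset a; b; p].
  have [D' _ _] := wall_sym W.
  by have := det3_apex_notin y1 y2 D'; rewrite subKr.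
have := amp _ Sp (cardfs3 ab ap bp) mu mu_cone _ m_ray m_notin.
rewrite mu_m; have : (2 : int)%:~R <= (y1 + y2)%:~R :> rat by rewrite ler_int.
lra.
Qed.

Lemma wall_star_sub_keep F tau a b p y1 y2 : wall F a b p y1 y2 ->
  ~~ (tau `<=` [fset a; b; p]) -> ~~ (tau `<=` [fset a; b; y1 *: a + y2 *: b - p]) ->
  wall (star_sub F tau) a b p y1 y2.
Proof. by move=> [D Sp Sm] np nm; split => //; apply: star_sub_keep. Qed.

Lemma wall_star_sub_apex F tau a b p y1 y2 : face_closed F -> wall F a b p y1 y2 ->
  p \in tau -> tau `<=` [fset a; b; p] ->
  wall (star_sub F tau) a b (gens_sum tau) (y1 + (a \in tau)%:R) (y2 + (b \in tau)%:R).
Proof.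
move=> fc [D Sp Sm] pt sub; have [ab ap bp] := det3_neq D.
have uE : gens_sum tau = (a \in tau)%:R *: a + (b \in tau)%:R *: b + 1 *: p.
  by rewrite (gens_sum_sub3 ab ap bp sub) pt.
have p_notin_ab : p \notin [fset a; b] by rewrite !inE negb_or eq_sym ap eq_sym bp.
split.
- by rewrite uE det3_lincomb mul1r.
- apply: star_sub_join; first by apply: fc Sp _; fset_sub.
  + by apply/fsubsetPn; exists p.
  + rewrite (_ : _ `|` tau = [fset a; b; p]) //.
    by apply/eqP; rewrite eqEfsubset fsubUset fsubsetUl sub fsetUS ?fsub1set.
- have -> : (y1 + (a \in tau)%:R) *: a + (y2 + (b \in tau)%:R) *: b - gens_sum tau =
            y1 *: a + y2 *: b - p by rewrite uE; vec_ring.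
  apply: star_sub_keep Sm _; apply/fsubsetPn; exists p => //.
  exact: det3_apex_notin.
Qed.

Lemma wall_star_sub_edge F a b p y1 y2 : face_closed F -> wall F a b p y1 y2 ->
  wall (star_sub F [fset a; b]) a (a + b) p (y1 - y2) y2 /\
  wall (star_sub F [fset a; b]) (a + b) p a 1 0.
Proof.
move=> fc W; have [D Sp Sm] := W; have [ab ap bp] := det3_neq D.
have [Dm _ _] := wall_sym W; have [_ _ bm] := det3_neq Dm.
set m := y1 *: a + y2 *: b - p in Sm bm.
set G := star_sub F [fset a; b].
have join x y c : [fset a; b; c] \in F -> [fset x; c] `|` [fset a; b] = [fset a; b; c] ->
    y \in [fset a; b] -> y \notin [fset x; c] -> [fset x; c; a + b] \in G.
  move=> Sc E yab ynS; rewrite -(gens_sum2 ab); apply: star_sub_join; last by rewrite E.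
    by apply: fc Sc _; rewrite -E fsubsetUl.
  by apply/fsubsetPn; exists y.
have Cap : [fset a; p; a + b] \in G.
  apply: (join a b p Sp); first fset_eq; first by rewrite !inE eqxx orbT.
  by rewrite !inE negb_or eq_sym ab bp.
have Cbp : [fset b; p; a + b] \in G.
  apply: (join b a p Sp); first fset_eq; first by rewrite !inE eqxx.
  by rewrite !inE negb_or ab ap.
have Cam : [fset a; m; a + b] \in G.
  apply: (join a b m Sm); first fset_eq; first by rewrite !inE eqxx orbT.
  by rewrite !inE negb_or eq_sym ab bm.
split; split.
- by rewrite det3_addr.
- by rewrite (_ : [fset a; a + b; p] = [fset a; p; a + b]) //; fset_eq.
- have -> : (y1 - y2) *: a + y2 *: (a + b) - p = m by rewrite /m; vec_ring.
  by rewrite (_ : [fset a; a + b; m] = [fset a; m; a + b]) //; fset_eq.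
- by rewrite det3_rot det3_addr.
- by rewrite (_ : [fset a + b; p; a] = [fset a; p; a + b]) //; fset_eq.
- have -> : 1 *: (a + b) + 0 *: p - a = b by vec_ring.
  by rewrite (_ : [fset a + b; p; b] = [fset b; p; a + b]) //; fset_eq.
Qed.

Definition steep_wall (F : fan) : Prop := exists a b p (y1 y2 : int),
  [/\ wall F a b p y1 y2, 0 <= y1, 0 <= y2 & (2 <= y1) || (2 <= y2)].

(* What subdividing a steep wall with coefficients (2, 1) leaves behind. *)
Definition balanced_walls (F : fan) : Prop := exists a b p (k : int),
  [/\ wall F a b p 1 1, wall F b p a 1 k & 0 <= k].

Lemma steep_wall_star_sub_apex F tau a b p y1 y2 : face_closed F -> wall F a b p y1 y2 ->
  p \in tau -> tau `<=` [fset a; b; p] -> 0 <= y1 -> 0 <= y2 ->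
  (2 <= y1 + (a \in tau)%:R) || (2 <= y2 + (b \in tau)%:R) -> steep_wall (star_sub F tau).
Proof.
move=> fc W pt sub h1 h2 h12.
exists a, b, (gens_sum tau), (y1 + (a \in tau)%:R), (y2 + (b \in tau)%:R).
split => //; first exact: (wall_star_sub_apex fc W pt sub).
all: by apply: addr_ge0.
Qed.

Lemma steep_wall_star_sub_edge F a b p y1 y2 : face_closed F -> wall F a b p y1 y2 ->
  0 <= y1 -> 0 <= y2 -> (2 <= y1) || (2 <= y2) ->
  steep_wall (star_sub F [fset a; b]) \/ balanced_walls (star_sub F [fset a; b]).
Proof.
wlog le21 : a b y1 y2 / y2 <= y1.
  move=> hwlog fc W h1 h2 h12; have [le21|lt12] := lerP y2 y1.
    exact: hwlog le21 fc W h1 h2 h12.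
  rewrite (_ : [fset a; b] = [fset b; a]); last exact: fsetUC.
  by apply: hwlog (wall_swap W) _ _ _ => //; [exact: ltW | rewrite orbC].
move=> fc W h1 h2 h12; have [Wa Wu] := wall_star_sub_edge fc W.
have [steep | flat] := boolP ((2 <= y1 - y2) || (2 <= y2)).
  by left; exists a, (a + b), p, (y1 - y2), y2; split => //; rewrite subr_ge0.
have [y1E y2E] : y1 = 2 /\ y2 = 1 by move/orP: h12; move: flat; rewrite negb_or -!ltNge; lia.
by right; exists a, (a + b), p, 0; move: Wa; rewrite y1E y2E.
Qed.

Lemma steep_wall_star_sub F tau : face_closed F -> (2 <= #|` tau|)%N -> steep_wall F ->
  steep_wall (star_sub F tau) \/ balanced_walls (star_sub F tau).
Proof.
move=> fc ct [a [b [p [y1 [y2 [W h1 h2 h12]]]]]].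
have steep_apex p' : wall F a b p' y1 y2 -> p' \in tau -> tau `<=` [fset a; b; p'] ->
    steep_wall (star_sub F tau).
  move=> W' pt sub; apply: steep_wall_star_sub_apex fc W' pt sub h1 h2 _.
  by move/orP: h12 => h12; apply/orP; case: (a \in tau); case: (b \in tau); lia.
case sp: (tau `<=` [fset a; b; p]).
  have [pt|pnt] := boolP (p \in tau); first by left; apply: steep_apex W pt sp.
  by rewrite (fsubset3_notin sp ct pnt); exact: steep_wall_star_sub_edge fc W h1 h2 h12.
case sm: (tau `<=` [fset a; b; y1 *: a + y2 *: b - p]).
  have [mt|mnt] := boolP (y1 *: a + y2 *: b - p \in tau).
    by left; apply: steep_apex (wall_sym W) mt sm.
  by move: sp; rewrite (fsubset3_notin sm ct mnt) fsubsetUl.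
by left; exists a, b, p, y1, y2; split => //; apply: wall_star_sub_keep; rewrite ?sp ?sm.
Qed.

Lemma balanced_walls_star_sub F tau : face_closed F -> (2 <= #|` tau|)%N -> balanced_walls F ->
  steep_wall (star_sub F tau) \/ balanced_walls (star_sub F tau).
Proof.
move=> fc ct [a [b [p [k [W1 W2 hk]]]]].
have steep_apex p' : wall F a b p' 1 1 -> p' \in tau -> tau `<=` [fset a; b; p'] ->
    steep_wall (star_sub F tau).
  move=> W pt sub; apply: (steep_wall_star_sub_apex fc W pt sub) => //.
  by have := fsubset3_mem sub ct; case: (a \in tau); case: (b \in tau).
case sp: (tau `<=` [fset a; b; p]).
  have [pt|pnt] := boolP (p \in tau); first by left; apply: steep_apex W1 pt sp.
  have tauE := fsubset3_notin sp ct pnt.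
  left; apply: steep_wall_star_sub_apex fc W2 _ _ _ hk _ => //; rewrite tauE.
  - by rewrite !inE eqxx.
  - by fset_sub.
  - by rewrite !inE eqxx orbT.
case sm: (tau `<=` [fset a; b; 1 *: a + 1 *: b - p]).
  have [mt|mnt] := boolP (1 *: a + 1 *: b - p \in tau).
    by left; apply: steep_apex (wall_sym W1) mt sm.
  by move: sp; rewrite (fsubset3_notin sm ct mnt) fsubsetUl.
have sp' : ~~ (tau `<=` [fset b; p; a]).
  by rewrite (_ : [fset b; p; a] = [fset a; b; p]) ?sp //; fset_eq.
set c := 1 *: b + k *: p - a.
case sc: (tau `<=` [fset b; p; c]); last first.
  by right; exists a, b, p, k; split => //; apply: wall_star_sub_keep; rewrite ?sp ?sm ?sc.
have [ct'|cnt] := boolP (c \in tau); last first.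
  by move: sp'; rewrite (fsubset3_notin sc ct cnt) fsubsetUl.
have W2' := wall_sym W2; have [Dc _ _] := W2'; have [bp bc pc] := det3_neq Dc.
have [bt|bnt] := boolP (b \in tau).
  by left; apply: (steep_wall_star_sub_apex fc W2' ct' sc) => //; rewrite bt.
have pt : p \in tau by have := fsubset3_mem sc ct; rewrite (negbTE bnt).
right; exists a, b, p, (k + 1); split.
- by apply: wall_star_sub_keep; rewrite ?sp ?sm.
- have := wall_sym (wall_star_sub_apex fc W2' ct' sc).
  rewrite (gens_sum_sub3 bp bc pc sc) (negbTE bnt) pt ct' /=.
  by have -> : 1 *: b + (k + 1) *: p - (0 *: b + 1 *: p + 1 *: c) = a by rewrite /c; vec_ring.
- exact: addr_ge0 hk ler01.
Qed.

Lemma blowups_not_anticanonical_ample F G : blowups F G -> face_closed F ->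
  steep_wall F \/ balanced_walls F -> ~ anticanonical_ample G.
Proof.
elim=> {F G} [F | F G H [tau [_ ct ->]] _ IH] fc hF.
  case: hF => [[a [b [p [y1 [y2 [W h1 h2 h12]]]]]] | [a [b [p [k [W _ _]]]]]];
    apply: wall_not_anticanonical_ample fc W _ => //.
  by move/orP: h12; lia.
apply: IH; first exact: face_closed_star_sub.
by case: hF; [apply: steep_wall_star_sub | apply: balanced_walls_star_sub].
Qed.

Theorem lemma4p1 (Z : fan) (v1 v2 vp vm : vec) (x1 x2 : int) :
  smooth_fan Z -> convex_support Z ->
  [fset v1; v2; vp] \in Z -> #|` [fset v1; v2; vp]| = 3%N ->
  [fset v1; v2; vm] \in Z -> #|` [fset v1; v2; vm]| = 3%N ->
  (vp + vm = x1 *: v1 + x2 *: v2)%R ->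
  (0 <= x2)%R -> (x2 <= x1)%R -> (2 <= x1)%R ->
  forall Z' : fan, blowups Z Z' -> ~ anticanonical_ample Z'.
Proof.
move=> [smooth fc _] _ Sp card_p Sm _ sum_pm x2_ge0 _ x1_ge2 Z' blow.
apply: (blowups_not_anticanonical_ample blow fc); left.
exists v1, v2, vp, x1, x2; split; last by rewrite x1_ge2.
- split; [exact: smooth_cone_det3 (smooth _ Sp) card_p | exact: Sp |].
  by rewrite -sum_pm addrAC subrr add0r.
- exact: le_trans _ x1_ge2.
- exact: x2_ge0.
Qed.
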